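(* Let $k\ge3$ and let $\varrho$ be a probability distribution on $S_k$ assigning positive probability to each element of $S_k$. For $n\ge1$ let $\mathbb{P}$ denote the distribution $\varrho^{\otimes n}$ on $S_k^n$. Then for every $\epsilon>0$ there exists $\delta=\delta(\epsilon,\varrho)>0$ such that for every $n$, if $F:S_k^n\to\{-1,1\}^{\binom{k}{2}}$ satisfies - IIA, and - $\mathbb{P}\{F(\sigma)\text{ is transitive}\}\ge1-\delta$, then there exists a function $G:S_k^n\to\{-1,1\}^{\binom{k}{2}}$ which is transitive and satisfies the IIA property, and for which $\mathbb{P}\{F(\sigma)\ne G(\sigma)\}\le\epsilon$.
   Context: There are $n$ voters and a set of $k$ alternatives. $S_k$ is identified with the set of strict rankings (linear orders) of the $k$ alternatives; an element $\sigma=(\sigma(1),\dots,\sigma(n))\in S_k^n$ records the ranking of each voter. An element of $\{-1,1\}^{\binom k2}$ records, for each unordered pair $\{a,b\}$ of distinct alternatives, a strict preference between $a$ and $b$ (with a fixed sign convention for each pair); it is called transitive if this collection of pairwise preferences is a transitive relation, i.e. comes from a linear order of the alternatives. A function $F:S_k^n\to\{-1,1\}^{\binom k2}$ is transitive if $F(\sigma)$ is transitive for all $\sigma\in S_k^n$. $F$ satisfies IIA (independence of irrelevant alternatives) if for every pair of alternatives $a,b$, the preference of $F(\sigma)$ between $a$ and $b$ is determined by the individual voters' preferences between $a$ and $b$ alone (i.e. by the vector recording, for each voter $j$, whether $\sigma(j)$ ranks $a$ above $b$). *)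

(* Defs.v *)
From HB Require Import structures.
From mathcomp Require Import all_boot all_order all_algebra all_fingroup.
From mathcomp Require Import reals.

Set Implicit Arguments.
Unset Strict Implicit.
Unset Printing Implicit Defensive.

Import Order.TTheory GRing.Theory Num.Theory.
Local Open Scope ring_scope.

(* A ranking s : 'S_k sends each alternative to its position, 0 being the top. *)
Definition ranks_above (k : nat) (s : 'S_k) (a b : 'I_k) : bool :=
  (s a < s b)%N.

Definition profile (n k : nat) := {ffun 'I_n -> 'S_k}.

(* An unordered pair of distinct alternatives is represented by its increasing
   enumeration. *)
Definition altpair (k : nat) := {p : 'I_k * 'I_k | (p.1 < p.2)%N}.

(* {-1,1}^(k choose 2), with the signs 1 and -1 encoded as true and false: the
   coordinate of a pair a < b is true iff a is preferred to b. *)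
Definition preferences (k : nat) := {ffun altpair k -> bool}.

Definition prefers (k : nat) (x : preferences k) (a b : 'I_k) : bool :=
  if insub (a, b) is Some p then x p
  else if insub (b, a) is Some p then ~~ x p
  else false.

Definition transitive_pref (k : nat) (x : preferences k) : bool :=
  [forall a, forall b, forall c,
     prefers x a b && prefers x b c ==> prefers x a c].

Definition IIA (n k : nat) (F : profile n k -> preferences k) : Prop :=
  forall (a b : 'I_k) (s t : profile n k),
    (forall j, ranks_above (s j) a b = ranks_above (t j) a b) ->
    prefers (F s) a b = prefers (F t) a b.

Definition is_distribution (R : realType) (T : finType) (rho : T -> R) : Prop :=
  (forall t, 0 <= rho t) /\ \sum_t rho t = 1.

(* Probability of the event E under the n-fold product of rho. *)
Definition product_prob (R : realType) (n k : nat) (rho : 'S_k -> R)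
    (E : pred (profile n k)) : R :=
  \sum_(s : profile n k | E s) \prod_(j < n) rho (s j).

(* Main.v *)
Require Import Defs.
From HB Require Import structures.
From mathcomp Require Import all_boot all_order all_algebra all_fingroup.
From mathcomp Require Import reals.
From mathcomp Require Import ring lra zify.

Set Implicit Arguments.
Unset Strict Implicit.
Unset Printing Implicit Defensive.

Import Order.TTheory GRing.Theory Num.Theory.
Local Open Scope ring_scope.

(** Why the theorem holds.

By IIA, the preference of F between a and b is a Boolean function f of the
vector x of the voters' preferences between a and b. For three alternatives
a, b, c this gives functions f, g, h of the vectors x, y, z of preferences on
(a,b), (b,c), (c,a), and F is transitive on the triple exactly when
f(x), g(y), h(z) are not all equal. The heart of the proof is
[near_all_equal_free]: if f(x) = g(y) = h(z) is improbable, then either two of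
the functions are nearly constant with opposite values, or each of them nearly
depends on a single voter.

Resample a ranking conditionally on its preferences on (b,c) and (c,a): this
changes x but not y and z. Given a set I of voters, resample x in this way on
I and y, likewise, on the complement of I. If f changes in the first operation
and g in the second, then one of the four combinations of old and new vectors
has f = g = h, because h does not move; and each combination has the original
distribution. So both changes are rarely seen together. Two events, one about
the x-vectors and the other about the y-vectors, that have probability bounded
below also meet with probability bounded below, however many voters there are
([cross_exponent_exists], a form of reverse hypercontractivity). Hence for every
I, either f is insensitive to I or g is insensitive to the complement of I
([sensitivity_dichotomy]). If f and g are far from constant, it follows that f
itself is insensitive to I or to its complement. The sets to which f is
sensitive then behave like an approximate ultrafilter, which must be principal:
let the initial segments {0, ..., m-1} of voters grow until f becomes sensitive;
f is insensitive to all voters but the last one added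
([sensitivity_concentrates]), so it is nearly a function of this one voter
([insensitive_near_junta]).

If h is nearly constant with value v, then f = v and g = v rarely hold together,
so f or g is nearly constant with the opposite value ([near_const_cascade]).

To obtain G, replace each pairwise function of F by a function of one voter when
one is close enough, and keep it otherwise. A violation of transitivity by G on
a triple of one-voter functions would occur on a cylinder over at most three
voters, whose probability is bounded below independently of n, whereas G is
close to F; so there is none. On a triple with two nearly constant functions,
the same argument shows that G is constant, with opposite values, on these two
pairs. *)

(** * Powers against parabolas *)

Lemma expr_ge_quadratic (R : realType) (u : R) (m : nat) :
  -1 <= u -> 1 + m.+1%:R * u + m%:R * u ^+ 2 <= (1 + u) ^+ m.+1.
Proof.
move=> hu; elim: m => [|m IH]; first by rewrite mul0r expr1 mul1r addr0.
rewrite exprS; apply: le_trans (ler_wpM2l _ IH); last by lra.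
have hu1 : 0 <= 1 + u by lra.
have h : 0 <= m%:R * u ^+ 2 * (1 + u) by rewrite mulr_ge0 // mulr_ge0 ?sqr_ge0.
rewrite -[m.+2%:R]natr1 -[m.+1%:R]natr1; nra.
Qed.

(** On all of u >= -1 the coefficient of u ^+ 2 could not exceed C - 1. Away
from u = -1 it can be C / beta for arbitrarily small beta: apply the quadratic
bound to the power M.+1, and again to the power M ^ 2 of the result. *)
Lemma expr_ge_steep_parabola (R : realType) (beta u : R) (M C : nat) :
  C = (M.+1 * M ^ 2)%N -> 0 < beta -> (2 <= M)%N -> 2 <= beta * M%:R ->
  -1 <= M%:R * u ->
  1 + C%:R * u + C%:R / beta * u ^+ 2 <= (1 + u) ^+ C.
Proof.
move=> -> hb hM hbM hu.
have hM' : (2 : R) <= M%:R by rewrite (ler_nat R 2).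
have hu1 : -1 <= u by nra.
have [l hlM] : exists l, (M ^ 2 = l.+1)%N by exists (M ^ 2).-1; nia.
have hl : (3 <= l)%N by nia.
rewrite hlM {hlM}.
have hl' : (3 : R) <= l%:R by rewrite (ler_nat R 3).
have h1 := expr_ge_quadratic M hu1.
set w := M.+1%:R * u + M%:R * u ^+ 2.
have hw : 1 + w = (1 + u) * (1 + M%:R * u) by rewrite /w -[M.+1%:R]natr1; ring.
have hw0 : 0 <= 1 + w by rewrite hw mulr_ge0 //; lra.
rewrite exprM.
apply: (@le_trans _ _ ((1 + w) ^+ l.+1)); last first.
  by apply: lerXn2r; rewrite ?nnegrE ?exprn_ge0 //; [lra | rewrite /w; lra].
have h2 := @expr_ge_quadratic R w l.
apply: le_trans (h2 _); last by lra.
have h3 : (M%:R * u) ^+ 2 <= w ^+ 2.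
  have -> : w = u * (M.+1%:R + M%:R * u) by rewrite /w; ring.
  rewrite mulrC !exprMn ler_wpM2l ?sqr_ge0 //.
  apply: lerXn2r; rewrite ?nnegrE -?natr1; lra.
have h4 : l%:R * (M%:R * u) ^+ 2 <= l%:R * w ^+ 2 by rewrite ler_wpM2l.
suff h5 : (M.+1 * l.+1)%:R / beta <= l.+1%:R * M%:R + l%:R * M%:R ^+ 2.
  have := ler_wpM2r (sqr_ge0 u) h5.
  rewrite /w natrM -[M.+1%:R]natr1; nra.
rewrite ler_pdivrMr // natrM -natr1 -[l.+1%:R]natr1.
set m : R := M%:R in hM' hbM *; set L : R := l%:R in hl' *.
have h6 : 2 * (L * m + m + L * m ^+ 2) <= beta * m * (L * m + m + L * m ^+ 2).
  by rewrite ler_wpM2r // !addr_ge0 ?mulr_ge0 ?sqr_ge0; lra.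
have : 0 <= m * (L * m + 1 + L) by nra.
rewrite -(ler_pM2l (_ : 0 < m)); nra.
Qed.

(** * Two functions on one coordinate *)

(** A form of full joint support that only concerns the values taken with
positive mass: it allows a or b to be degenerate, as happens for the pair of old and new
preferences of a voter who does not move. *)
Definition crossing (R : realType) (T : finType) (U V : Type) (beta : R)
    (w : T -> R) (a : T -> U) (b : T -> V) : Prop :=
  forall t t', 0 < w t -> 0 < w t' ->
    exists t'', [/\ a t'' = a t, b t'' = b t' & beta <= w t''].

Lemma is_distribution_max (R : realType) (T : finType) (w f : T -> R) :
  is_distribution w ->
  exists2 t, 0 < w t & \sum_t w t * f t <= f t.
Proof.
case=> w0 w1; have [/existsP [t /andP [ht hf]]|/existsPn hn] :=
    boolP [exists t, (0 < w t) && (\sum_t w t * f t <= f t)]; first by exists t.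
set c := \sum_t _ in hn *.
have h t : 0 <= w t * (c - f t).
  have := hn t; rewrite negb_and -leNgt -ltNge => /orP [ht|ht].
    by rewrite (_ : w t = 0) ?mul0r //; apply/eqP; rewrite eq_le ht w0.
  by rewrite mulr_ge0 // subr_ge0 ltW.
have h0 : \sum_t w t * (c - f t) = 0.
  under eq_bigr do rewrite mulrBr.
  by rewrite sumrB -mulr_suml w1 mul1r subrr.
have [t ht] : exists t, 0 < w t.
  apply/existsP; apply: contraT => /existsPn hw.
  have : \sum_t w t <= 0 by apply: sumr_le0 => t _; rewrite leNgt.
  by rewrite w1 ler10.
have /eqP := psumr_eq0P (fun t _ => h t) h0 (erefl : xpredT t).
rewrite mulf_eq0 gt_eqF //= subr_eq0 => /eqP hc.
by exists t => //; rewrite hc.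
Qed.

(** If a is somewhere notably below its mean 1, it is elsewhere at least 1 + e,
with e of order beta / M. Crossing places this high value of a on
top of a value at least 1 of b with mass beta, and the power C makes that single
point contribute at least 1. *)
Lemma expectation_ge_outlier (R : realType) (T : finType) (w a b : T -> R)
    (beta : R) (M C : nat) :
  is_distribution w -> crossing beta w a b -> 0 < beta -> beta <= 1 ->
  (forall t, 0 <= a t) -> (forall t, 0 <= b t) ->
  \sum_t w t * a t = 1 -> \sum_t w t * b t = 1 ->
  (2 <= M)%N -> 2 <= beta * M%:R -> C = (M.+1 * M ^ 2)%N ->
  (exists2 t, 0 < w t & a t < 1 - (2 * M%:R)^-1) ->
  1 <= \sum_t w t * (a t * b t) ^+ C.
Proof.
move=> hw hx hb hb1 a0 b0 ea eb hM hbM hC [t0 ht0 hat0].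
case: (hw) => w0 w1.
have hM0 : (0 : R) < M%:R by rewrite (ltr_nat R 0); lia.
set th := (2 * M%:R)^-1 in hat0.
have hth : th * (2 * M%:R) = 1 by rewrite /th mulVf // gt_eqF // mulr_gt0.
have hth0 : 0 < th by rewrite /th invr_gt0 mulr_gt0.
have [t1 [hat1 _ hwt1]] := hx t0 t0 ht0 ht0.
pose e := beta * th.
have [t2 hwt2 hat2] : exists2 t, 0 < w t & 1 + e <= a t.
  have [/existsP [t /andP [ht hf]]|/existsPn hn] :=
    boolP [exists t, (0 < w t) && (1 + e <= a t)]; first by exists t.
  have h t : 0 <= w t * (1 + e - a t).
    have := hn t; rewrite negb_and -leNgt -ltNge => /orP [ht|ht].
      by rewrite (_ : w t = 0) ?mul0r //; apply/eqP; rewrite eq_le ht w0.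
    by rewrite mulr_ge0 // subr_ge0 ltW.
  have h0 : \sum_t w t * (1 + e - a t) = e.
    under eq_bigr do rewrite mulrBr.
    by rewrite sumrB -mulr_suml w1 mul1r ea addrAC subrr add0r.
  have : w t1 * (1 + e - a t1) <= e.
    by rewrite -[X in _ <= X]h0 (bigD1 t1) //= lerDl sumr_ge0.
  have : beta * (1 + e - a t1) <= w t1 * (1 + e - a t1).
    by rewrite ler_wpM2r // hat1 /e; nra.
  have : 0 < beta * e by rewrite !mulr_gt0.
  rewrite hat1 /e; nra.
have [t3 hwt3 hbt3] := is_distribution_max b hw.
rewrite eb in hbt3.
have [t4 [hat4 hbt4 hwt4]] := hx t2 t3 hwt2 hwt3.
have he : -1 <= e by rewrite /e; have : 0 < beta * th; [rewrite mulr_gt0 | lra].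
have h1 : 1 + C%:R * e <= (a t4 * b t4) ^+ C.
  have [c hc] : exists c, C = c.+1 by exists C.-1;
    rewrite prednK // hC muln_gt0 expn_gt0 (ltnW hM).
  have h2 := expr_ge_quadratic c he.
  have h3 : 0 <= c%:R * e ^+ 2 by rewrite mulr_ge0 ?sqr_ge0.
  rewrite -hc in h2; apply: le_trans (_ : (1 + e) ^+ C <= _); first by lra.
  apply: lerXn2r; rewrite ?nnegrE ?mulr_ge0 //; first by lra.
  by rewrite hat4 hbt4; apply: le_trans hat2 _; rewrite ler_peMr.
apply: (@le_trans _ _ (w t4 * (a t4 * b t4) ^+ C)); last first.
  rewrite (bigD1 t4) //= lerDl sumr_ge0 // => t _.
  by rewrite mulr_ge0 // exprn_ge0 // mulr_ge0.
apply: (@le_trans _ _ (beta * (1 + C%:R * e))).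
  have h5 : 2 <= C%:R * (beta * e).
    have -> : C%:R * (beta * e) = (M.+1%:R * th * M%:R) * (beta * M%:R) * beta.
      by rewrite hC natrM natrX /e; ring.
    have -> : M.+1%:R * th * M%:R = (1 + M%:R) / 2.
      have : th * M%:R = 1 / 2 by lra.
      by rewrite -natr1 -mulrA => ->; lra.
    nra.
  lra.
apply: le_trans (ler_wpM2r _ hwt4) _; last by rewrite ler_wpM2l.
by rewrite addr_ge0 // mulr_ge0 // /e mulr_ge0 // ltW.
Qed.

(** At a point t with a t >= 1, cross with a value of b at least 1: the product
a * b is then at least as far from 1 as a t. If a t < 1, cross with a value of b
at most 1. Averaging over t gives the variance of a. *)
Lemma crossing_sqr_le (R : realType) (T : finType) (w a b : T -> R) (beta : R) :
  is_distribution w -> crossing beta w a b -> 0 < beta ->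
  (forall t, 0 <= a t) -> \sum_t w t * b t = 1 ->
  beta * (\sum_t w t * (a t - 1) ^+ 2) <= \sum_t w t * (a t * b t - 1) ^+ 2.
Proof.
move=> hw hx hb a0 eb; case: (hw) => w0 w1.
set S := (X in _ <= X).
have hS t : 0 < w t -> beta * (a t - 1) ^+ 2 <= S.
  move=> ht.
  have hS1 t1 : 0 < w t1 -> (a t - 1) ^+ 2 <= (a t * b t1 - 1) ^+ 2 ->
      beta * (a t - 1) ^+ 2 <= S.
    move=> ht1 hle; have [t2 [ha2 hb2 hw2]] := hx t t1 ht ht1.
    apply: (@le_trans _ _ (w t2 * (a t2 * b t2 - 1) ^+ 2)).
      by rewrite ha2 hb2; apply: ler_pM; rewrite ?sqr_ge0 // ltW.
    rewrite /S (bigD1 t2) //= lerDl sumr_ge0 // => t' _.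
    by rewrite mulr_ge0 ?sqr_ge0.
  have := a0 t; have [ha _|ha hat] := leP 1 (a t).
    have [t1 hw1 hbt1] := is_distribution_max b hw.
    rewrite eb in hbt1; apply: (hS1 t1) => //.
    by apply: lerXn2r; rewrite ?nnegrE; nra.
  have [t1 hw1 hbt1] := is_distribution_max (fun t => - b t) hw.
  have hbt : b t1 <= 1.
    rewrite -lerN2; apply: le_trans hbt1; rewrite -eb -sumrN.
    by apply: ler_sum => t' _; rewrite mulrN.
  apply: (hS1 t1) => //; rewrite -(sqrrN (a t - 1)) -(sqrrN (a t * _ - 1)).
  by apply: lerXn2r; rewrite ?nnegrE; nra.
apply: (@le_trans _ _ (\sum_t w t * S)); last by rewrite -mulr_suml w1 mul1r.
rewrite mulr_sumr; apply: ler_sum => t _; rewrite mulrCA.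
have := w0 t; rewrite le_eqVlt => /orP [/eqP <-|ht]; first by rewrite !mul0r.
by rewrite ler_wpM2l // hS.
Qed.

Lemma crossingC (R : realType) (T : finType) (U V : Type) (beta : R)
    (w : T -> R) (a : T -> U) (b : T -> V) :
  crossing beta w a b -> crossing beta w b a.
Proof. by move=> h t t' ht ht'; have [t2 []] := h t' t ht' ht; exists t2. Qed.

(** Without low outliers, a * b = 1 + u with u in the range of the parabola
above. Its linear term contributes the covariance of a and b, which may be
negative but is at least minus the mean of the two variances; its square term
dominates both variances by [crossing_sqr_le]. *)
Lemma expectation_power_ge1 (R : realType) (T : finType) (w a b : T -> R)
    (beta : R) (M C : nat) :
  is_distribution w -> crossing beta w a b -> 0 < beta -> beta <= 1 ->
  (forall t, 0 <= a t) -> (forall t, 0 <= b t) ->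
  \sum_t w t * a t = 1 -> \sum_t w t * b t = 1 ->
  (2 <= M)%N -> 2 <= beta * M%:R -> C = (M.+1 * M ^ 2)%N ->
  1 <= \sum_t w t * (a t * b t) ^+ C.
Proof.
move=> hw hx hb hb1 a0 b0 ea eb hM hbM hC; case: (hw) => w0 w1.
have [/existsP [t /andP [ht hat]]|/existsPn ha] :=
    boolP [exists t, (0 < w t) && (a t < 1 - (2 * M%:R)^-1)].
  apply: (expectation_ge_outlier hw hx hb hb1 a0 b0 ea eb hM hbM hC).
  by exists t.
have [/existsP [t /andP [ht hbt]]|/existsPn hbn] :=
    boolP [exists t, (0 < w t) && (b t < 1 - (2 * M%:R)^-1)].
  under eq_bigr do rewrite mulrC.
  under eq_bigr do rewrite [_ * b _]mulrC mulrC.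
  apply: (expectation_ge_outlier hw (crossingC hx) hb hb1 b0 a0 eb ea hM hbM hC).
  by exists t.
have hM0 : (0 : R) < M%:R by rewrite (ltr_nat R 0); lia.
set th := (2 * M%:R)^-1 in ha hbn.
have hth : M%:R * th = 1 / 2.
  have : th * (2 * M%:R) = 1 by rewrite /th mulVf // gt_eqF // mulr_gt0.
  lra.
have hth0 : 0 < th by rewrite /th invr_gt0 mulr_gt0.
have hth1 : th <= 1 by have : (2 : R) <= M%:R; [rewrite (ler_nat R 2) | nra].
have [hC0 hCb] : 0 < (C%:R : R) /\ 0 < C%:R / beta.
  have hC0 : 0 < (C%:R : R) by rewrite (ltr_nat R 0); nia.
  by rewrite divr_gt0.
set u := fun t => a t * b t - 1.
have hu t : w t * (1 + C%:R * u t + C%:R / beta * u t ^+ 2) <=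
            w t * (a t * b t) ^+ C.
  have := w0 t; rewrite le_eqVlt => /orP [/eqP <-|ht]; first by rewrite !mul0r.
  rewrite ler_wpM2l //; have -> : a t * b t = 1 + u t by rewrite /u; ring.
  apply: (expr_ge_steep_parabola hC) => //.
  have := ha t; have := hbn t; rewrite ht /= -!leNgt => hbt hat.
  have : (1 - th) * (1 - th) <= a t * b t by apply: ler_pM; lra.
  move=> h; have : - (2 * th) <= u t by rewrite /u; nra.
  by move=> h'; have := ler_wpM2l (ltW hM0) h'; lra.
apply: le_trans (ler_sum _ (fun t _ => hu t)).
have h1 := crossing_sqr_le hw hx hb a0 eb.
have h2 := crossing_sqr_le hw (crossingC hx) hb b0 ea.
have h2' : beta * (\sum_t w t * (b t - 1) ^+ 2) <= \sum_t w t * u t ^+ 2.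
  apply: le_trans h2 _; apply: ler_sum => t _.
  by rewrite /u mulrC [b t * _]mulrC mulrC.
have -> : \sum_t w t * (1 + C%:R * u t + C%:R / beta * u t ^+ 2) =
    1 + C%:R * (\sum_t w t * u t) + C%:R / beta * (\sum_t w t * u t ^+ 2).
  under eq_bigr do rewrite mulrDr mulrDr mulr1.
  rewrite !big_split /= w1 !mulr_sumr.
  by congr (_ + _ + _); apply: eq_bigr => t _; rewrite mulrCA.
set Q := \sum_t w t * u t ^+ 2 in h1 h2' *.
have h3 : \sum_t w t * (a t - 1 + (b t - 1)) ^+ 2 =
    \sum_t w t * (a t - 1) ^+ 2 + \sum_t w t * (b t - 1) ^+ 2
    + 2 * \sum_t w t * u t.
  have -> : \sum_t w t * u t = \sum_t w t * ((a t - 1) * (b t - 1)).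
    apply/eqP; rewrite -subr_eq0 -sumrB.
    have -> : \sum_t (w t * u t - w t * ((a t - 1) * (b t - 1))) =
      \sum_t w t * a t + \sum_t w t * b t - 2 * \sum_t w t.
      rewrite mulr_sumr -big_split /= -sumrB; apply: eq_bigr => t _.
      by rewrite /u; ring.
    by rewrite ea eb w1; apply/eqP; ring.
  rewrite mulr_sumr -!big_split /=; apply: eq_bigr => t _; ring.
have h4 : 0 <= \sum_t w t * (a t - 1 + (b t - 1)) ^+ 2.
  by apply: sumr_ge0 => t _; rewrite mulr_ge0 ?sqr_ge0.
rewrite h3 in h4.
set SA := \sum_t w t * (a t - 1) ^+ 2 in h1 h4.
set SB := \sum_t w t * (b t - 1) ^+ 2 in h2' h4.
have h5 : SA <= beta^-1 * Q by rewrite mulrC ler_pdivlMr // mulrC.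
have h6 : SB <= beta^-1 * Q by rewrite mulrC ler_pdivlMr // mulrC.
set P := \sum_t w t * u t in h4 *.
have : 0 <= C%:R * (P + beta^-1 * Q) by rewrite mulr_ge0 //; lra.
rewrite mulrDr mulrA; lra.
Qed.

(** The one-coordinate inequality behind [cross_exponent_exists], obtained from
the normalized case by homogeneity. *)
Lemma expectation_power_le (R : realType) (T : finType) (w a b : T -> R)
    (beta : R) (M C : nat) :
  is_distribution w -> crossing beta w a b -> 0 < beta -> beta <= 1 ->
  (forall t, 0 <= a t) -> (forall t, 0 <= b t) ->
  (2 <= M)%N -> 2 <= beta * M%:R -> C = (M.+1 * M ^ 2)%N ->
  ((\sum_t w t * a t) * (\sum_t w t * b t)) ^+ C <=
  \sum_t w t * (a t * b t) ^+ C.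
Proof.
move=> hw hx hb hb1 a0 b0 hM hbM hC; case: (hw) => w0 w1.
set A := \sum_t w t * a t; set B := \sum_t w t * b t.
have hC0 : (0 < C)%N by nia.
have hA : 0 <= A by apply: sumr_ge0 => t _; rewrite mulr_ge0.
have hB : 0 <= B by apply: sumr_ge0 => t _; rewrite mulr_ge0.
have [/eqP hAB|hAB] := boolP (A * B == 0).
  rewrite hAB expr0n eqn0Ngt hC0; apply: sumr_ge0 => t _.
  by rewrite mulr_ge0 // exprn_ge0 // mulr_ge0.
have [hA0 hB0] : A != 0 /\ B != 0.
  by move: hAB; rewrite mulf_eq0 negb_or => /andP.
have hx' : crossing beta w (fun t => a t / A) (fun t => b t / B).
  move=> t t' ht ht'; have [t2 [e1 e2 h]] := hx t t' ht ht'.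
  by exists t2; rewrite e1 e2.
have : 1 <= \sum_t w t * (a t / A * (b t / B)) ^+ C.
  apply: (expectation_power_ge1 hw hx' hb hb1 _ _ _ _ hM hbM hC).
  - by move=> t; rewrite divr_ge0.
  - by move=> t; rewrite divr_ge0.
  - by under eq_bigr do rewrite mulrA; rewrite -mulr_suml divff.
  - by under eq_bigr do rewrite mulrA; rewrite -mulr_suml divff.
under eq_bigr do rewrite mulrACA -invfM exprMn exprVn mulrA.
rewrite -mulr_suml ler_pdivlMr ?mul1r //.
by rewrite exprn_gt0 // lt_def hAB mulr_ge0.
Qed.

(** * Product probabilities *)

Definition Pr (R : realType) (n : nat) (T : finType) (w : 'I_n -> T -> R)
    (E : pred {ffun 'I_n -> T}) : R :=
  \sum_(s | E s) \prod_j w j (s j).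

Definition along (n : nat) (T U : Type) (phi : 'I_n -> T -> U)
    (s : {ffun 'I_n -> T}) : {ffun 'I_n -> U} := [ffun j => phi j (s j)].

Definition fcons (n : nat) (T : Type) (t : T) (s : {ffun 'I_n -> T}) :
    {ffun 'I_n.+1 -> T} :=
  [ffun j => if unlift ord0 j is Some i then s i else t].

Section Pr.
Variables (R : realType) (n : nat) (T : finType) (w : 'I_n -> T -> R).
Hypothesis hw : forall j, is_distribution (w j).

Lemma PrE E : Pr w E = \sum_s (if E s then \prod_j w j (s j) else 0).
Proof. exact: big_mkcond. Qed.

Lemma weight_ge0 (s : {ffun 'I_n -> T}) : 0 <= \prod_j w j (s j).
Proof. by apply: prodr_ge0 => j _; case: (hw j). Qed.

Lemma Pr_ge0 E : 0 <= Pr w E.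
Proof. by apply: sumr_ge0 => s _; apply: weight_ge0. Qed.

Lemma Pr_total : Pr w xpredT = 1.
Proof. by rewrite /Pr -bigA_distr_bigA big1 // => j _; case: (hw j). Qed.

(** A union bound in which the covering of E is only required on the support:
resampled rankings share preferences only there. *)
Lemma Pr_le_sum (I : finType) (E : pred {ffun 'I_n -> T})
    (Es : I -> pred {ffun 'I_n -> T}) :
  (forall s : {ffun 'I_n -> T}, (forall j, 0 < w j (s j)) ->
     E s -> exists i, Es i s) ->
  Pr w E <= \sum_i Pr w (Es i).
Proof.
move=> h; under eq_bigr do rewrite PrE; rewrite exchange_big PrE /=.
apply: ler_sum => s _; have p0 := weight_ge0 s.
have hi i : 0 <= if Es i s then \prod_j w j (s j) else 0 by case: ifP.
case: ifP => [Es_s|_]; last exact: sumr_ge0.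
have [hs|/forallPn [j]] := boolP [forall j, 0 < w j (s j)]; last first.
  rewrite lt_def; case: (hw j) => -> _; rewrite andbT negbK => /eqP hj.
  have -> : \prod_j w j (s j) = 0 by rewrite (bigD1 j) //= hj mul0r.
  by apply: sumr_ge0 => i _; case: ifP.
have [i hsi] := h s (forallP hs) Es_s.
by rewrite (bigD1 i) //= hsi lerDl sumr_ge0.
Qed.

Lemma Pr_le (E E' : pred {ffun 'I_n -> T}) :
  (forall s, E s -> E' s) -> Pr w E <= Pr w E'.
Proof.
move=> h; have := @Pr_le_sum unit E (fun=> E').
rewrite big_const card_unit /= addr0.
by apply=> s _ /h; exists tt.
Qed.

Lemma Pr_leU (E E1 E2 : pred {ffun 'I_n -> T}) :
  (forall s, E s -> E1 s || E2 s) -> Pr w E <= Pr w E1 + Pr w E2.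
Proof.
move=> h; have := @Pr_le_sum bool E (fun b => if b then E1 else E2).
rewrite big_bool /=; apply=> s _ /h /orP [h1|h2]; first by exists true.
by exists false.
Qed.

Lemma Pr_compl (E : pred {ffun 'I_n -> T}) :
  Pr w (fun s => ~~ E s) = 1 - Pr w E.
Proof.
by rewrite -Pr_total {2}/Pr (bigID E xpredT) /= -/(Pr w E) addrAC subrr add0r.
Qed.

End Pr.

Lemma eq_Pr (R : realType) (n : nat) (T : finType) (w : 'I_n -> T -> R) E E' :
  E =1 E' -> Pr w E = Pr w E'.
Proof. exact: eq_bigl. Qed.

Lemma Pr_le_eq (R : realType) (n : nat) (T : finType) (w : 'I_n -> T -> R)
    (E E' : pred {ffun 'I_n -> T}) :
  E =1 E' -> Pr w E <= Pr w E'.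
Proof. by move/(eq_Pr w) => ->. Qed.

Lemma Pr_along (R : realType) (n : nat) (T U : finType) (w : 'I_n -> T -> R)
    (phi : 'I_n -> T -> U) (E : pred {ffun 'I_n -> U}) :
  Pr w (fun s => E (along phi s)) =
  Pr (fun j u => \sum_(t | phi j t == u) w j t) E.
Proof.
rewrite /Pr (partition_big (along phi) E) //=; apply: eq_bigr => u Eu.
rewrite bigA_distr_big_dep /=; apply: eq_bigl => s.
apply/andP/familyP => [[_ /eqP <-] j|h]; first by rewrite ffunE unfold_in.
have e : along phi s = u.
  by apply/ffunP => j; rewrite ffunE; apply/eqP; apply: h.
by rewrite e.
Qed.

Lemma eq_Pr_law (R : realType) (n : nat) (T T' U : finType)
    (w : 'I_n -> T -> R) (w' : 'I_n -> T' -> R)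
    (phi : 'I_n -> T -> U) (phi' : 'I_n -> T' -> U)
    (E : pred {ffun 'I_n -> U}) :
  (forall j u, \sum_(t | phi j t == u) w j t =
               \sum_(t | phi' j t == u) w' j t) ->
  Pr w (fun s => E (along phi s)) = Pr w' (fun s => E (along phi' s)).
Proof.
move=> h; rewrite !Pr_along; apply: eq_bigr => s _.
by apply: eq_bigr => j _; rewrite h.
Qed.

Lemma Pr_recl (R : realType) (n : nat) (T : finType) (w : 'I_n.+1 -> T -> R) E :
  Pr w E = \sum_t w ord0 t *
    Pr (fun j => w (lift ord0 j)) (fun s => E (fcons t s)).
Proof.
rewrite /Pr (reindex (fun p : T * {ffun 'I_n -> T} => fcons p.1 p.2)) /=.
  rewrite -(pair_big_dep xpredT (fun t s => E (fcons t s))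
    (fun t s => \prod_j w j (fcons t s j))) /=.
  apply: eq_bigr => t _; rewrite mulr_sumr; apply: eq_bigr => s _.
  rewrite big_ord_recl ffunE unlift_none; congr (_ * _).
  by apply: eq_bigr => j _; rewrite ffunE liftK.
exists (fun s => (s ord0, [ffun j => s (lift ord0 j)])) => [[t s] _|s _] /=.
  rewrite ffunE unlift_none; congr (_, _); apply/ffunP => j.
  by rewrite !ffunE liftK.
apply/ffunP => j; rewrite ffunE.
by case: unliftP => [i ->|->] //; rewrite ffunE.
Qed.

Lemma along_fcons (n : nat) (T U : Type) (phi : 'I_n.+1 -> T -> U) t s :
  along phi (fcons t s) =
  fcons (phi ord0 t) (along (fun j => phi (lift ord0 j)) s).
Proof.
apply/ffunP => j; rewrite !ffunE.
by case: unliftP => [i ->|->] //; rewrite ffunE.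
Qed.

(** * Events on two correlated vectors meet *)

(** Reverse hypercontractivity for indicator functions, with an exponent that is
the same for all n. *)
Definition cross_exponent (R : realType) (beta : R) (C : nat) : Prop :=
  forall (n : nat) (T : finType) (U V : Type) (w : 'I_n -> T -> R)
      (phi : 'I_n -> T -> U) (psi : 'I_n -> T -> V),
    (forall j, is_distribution (w j)) ->
    (forall j, crossing beta (w j) (phi j) (psi j)) ->
    forall (A : pred {ffun 'I_n -> U}) (B : pred {ffun 'I_n -> V}),
    (Pr w (fun s => A (along phi s)) * Pr w (fun s => B (along psi s))) ^+ C <=
    Pr w (fun s => A (along phi s) && B (along psi s)).

(** The inequality tensorizes: conditioning on the first coordinate t, the
conditional probabilities of the two events are functions a and b of the two
images of t, and [expectation_power_le] averages the induction hypothesis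
(a t * b t) ^+ C over t. *)
Lemma cross_exponent_exists (R : realType) (beta : R) :
  0 < beta -> beta <= 1 -> exists2 C : nat, (0 < C)%N & cross_exponent beta C.
Proof.
move=> hb hb1; pose M := (Num.bound (2 / beta)).+2.
have hbM : 2 <= beta * M%:R.
  have h0 : 0 <= 2 / beta by rewrite divr_ge0 // ltW.
  rewrite mulrC -ler_pdivrMr //; apply: le_trans (ltW (archi_boundP h0)) _.
  by rewrite ler_nat; apply: leqW; apply: leqW.
exists (M.+1 * M ^ 2)%N; first by rewrite muln_gt0 expn_gt0.
set C := (M.+1 * M ^ 2)%N; elim => [|n IH] T U V w phi psi hw hx A B.
  pose f : {ffun 'I_0 -> T} :=
    [ffun j : 'I_0 => False_rect T (notF (ltn_ord j))].
  have Pr0 (E : pred {ffun 'I_0 -> T}) : Pr w E = (E f)%:R.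
    rewrite (eq_Pr w (E' := fun=> E f)); last first.
      by move=> s; congr E; apply/ffunP => -[].
    by case: (E f); [rewrite Pr_total | rewrite /Pr big_pred0].
  rewrite !Pr0 -natrM mulnb; case: (_ && _); rewrite ?expr1n // expr0n.
  by rewrite eqn0Ngt muln_gt0 expn_gt0.
rewrite !Pr_recl.
pose w' j := w (lift ord0 j).
pose phi' j := phi (lift ord0 j); pose psi' j := psi (lift ord0 j).
pose a t := Pr w' (fun s => A (fcons (phi ord0 t) (along phi' s))).
pose b t := Pr w' (fun s => B (fcons (psi ord0 t) (along psi' s))).
have hw' j : is_distribution (w' j) by apply: hw.
rewrite (eq_bigr (fun t => w ord0 t * a t)); last first.
  by move=> t _; congr (_ * _); apply: eq_Pr => s; rewrite along_fcons.
rewrite [X in _ * X](eq_bigr (fun t => w ord0 t * b t)); last first.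
  by move=> t _; congr (_ * _); apply: eq_Pr => s; rewrite along_fcons.
apply: (le_trans
  (expectation_power_le (hw ord0) _ hb hb1 _ _ _ hbM (erefl C))) => //.
- move=> t t' ht ht'; have [t2 [h1 h2 h3]] := hx ord0 t t' ht ht'.
  by exists t2; rewrite /a /b h1 h2.
- by move=> t; apply: Pr_ge0.
- by move=> t; apply: Pr_ge0.
apply: ler_sum => t _; case: (hw ord0) => w0 _; rewrite ler_wpM2l //.
apply: le_trans (IH _ _ _ w' phi' psi' _ _ (fun f => A (fcons (phi ord0 t) f))
  (fun f => B (fcons (psi ord0 t) f))) _ => //; first by move=> j; apply: hx.
by apply: Pr_le_eq => s; rewrite !along_fcons.
Qed.

(** * Resampling rankings and sensitivity *)

Lemma along_comp (n : nat) (T U V : Type) (phi : 'I_n -> T -> U)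
    (psi : 'I_n -> U -> V) s :
  along psi (along phi s) = along (fun j t => psi j (phi j t)) s.
Proof. by apply/ffunP => j; rewrite !ffunE. Qed.

Definition voterwise (n : nat) (T U : Type) (X : T -> U)
    (s : {ffun 'I_n -> T}) : {ffun 'I_n -> U} :=
  along (fun=> X) s.

(** The joint law of a rho-random t and of an independent copy of t conditioned
to lie in the same class of c. *)
Definition resample (R : realType) (T : finType) (D : eqType) (rho : T -> R)
    (c : T -> D) (p : T * T) : R :=
  if c p.1 == c p.2 then rho p.1 * rho p.2 / \sum_(t | c t == c p.1) rho t
  else 0.

Definition hybrid (n : nat) (T : Type) (I : {set 'I_n}) (j : 'I_n)
    (p : T * T) : T :=
  if j \in I then p.2 else p.1.

Definition sensitivity (R : realType) (n : nat) (T : finType) (D : eqType)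
    (rho : T -> R) (c : T -> D) (X : T -> bool)
    (f : {ffun 'I_n -> bool} -> bool)
    (I : {set 'I_n}) : R :=
  Pr (fun=> resample rho c)
    (fun s => f (voterwise (fun p => X p.1) s) !=
              f (along (fun j p => X (hybrid I j p)) s)).

Section Resample.
Variables (R : realType) (T : finType) (D : eqType) (rho : T -> R) (c : T -> D).
Hypotheses (hrho : is_distribution rho) (hpos : forall t, 0 < rho t).

Lemma class_mass_gt0 t : 0 < \sum_(t' | c t' == c t) rho t'.
Proof.
rewrite (bigD1 t) //= ltr_pwDl // sumr_ge0 // => t' _; exact: ltW.
Qed.

Lemma resample_ge0 p : 0 <= resample rho c p.
Proof.
rewrite /resample; case: ifP => // _.
by rewrite divr_ge0 ?mulr_ge0 // ltW // class_mass_gt0.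
Qed.

Lemma resampleC t t' : resample rho c (t, t') = resample rho c (t', t).
Proof.
rewrite /resample /= eq_sym; case: ifP => // /eqP ->.
by rewrite [rho t * _]mulrC.
Qed.

Lemma resample_fst (P : pred T) :
  \sum_(p | P p.1) resample rho c p = \sum_(t | P t) rho t.
Proof.
transitivity (\sum_(t | P t) \sum_t' resample rho c (t, t')).
  rewrite pair_big_dep.
  by apply: eq_big => [[t t']|[t t'] _] //=; rewrite andbT.
apply: eq_bigr => t _; rewrite /resample /= -big_mkcond /=.
rewrite -mulr_suml -mulr_sumr.
rewrite [X in _ * X / _](eq_bigl (fun t' => c t' == c t)); last first.
  by move=> t'; rewrite eq_sym.
by rewrite mulfK // gt_eqF // class_mass_gt0.
Qed.

Lemma resample_snd (P : pred T) :
  \sum_(p | P p.2) resample rho c p = \sum_(t | P t) rho t.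
Proof.
rewrite -resample_fst (reindex_inj (h := fun p : T * T => (p.2, p.1))) /=.
  by apply: eq_bigr => -[t t'] _; rewrite resampleC.
by apply: (can_inj (g := fun p => (p.2, p.1))) => -[].
Qed.

Lemma resample_distribution : is_distribution (resample rho c).
Proof.
split; first exact: resample_ge0.
by rewrite (resample_fst xpredT); case: hrho.
Qed.

Lemma resample_ge (b : R) t t' : 0 < b -> (forall t, b <= rho t) ->
  c t = c t' -> b ^+ 2 <= resample rho c (t, t').
Proof.
move=> hb hr e; rewrite /resample /= e eqxx.
rewrite ler_pdivlMr ?class_mass_gt0 //.
apply: (@le_trans _ _ (b ^+ 2)).
  rewrite ler_piMr ?sqr_ge0 //; case: hrho => r0 <-.
  rewrite [leRHS](bigID (fun t1 => c t1 == c t')) /= lerDl.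
  by apply: sumr_ge0.
by rewrite expr2 ler_pM // ltW.
Qed.

End Resample.

Section Sensitivity.
Variables (R : realType) (n : nat) (T : finType) (D : eqType).
Variables (rho : T -> R) (c : T -> D) (X : T -> bool).
Variable (f : {ffun 'I_n -> bool} -> bool).
Hypotheses (hrho : is_distribution rho) (hpos : forall t, 0 < rho t).

Let hm := resample_distribution c hrho hpos.

(** Resample on I first, then on J. On I the second step compares the new value
with itself; as both members of a resampled pair have the same law, this looks
like a step from the original vector. *)
Lemma sensitivityU (I J : {set 'I_n}) : [disjoint I & J] ->
  sensitivity rho c X f (I :|: J) <=
  sensitivity rho c X f I + sensitivity rho c X f J.
Proof.
move=> hIJ.
pose d (u : {ffun 'I_n -> bool * bool}) :=
  f (voterwise fst u) != f (voterwise snd u).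
have -> : sensitivity rho c X f J = Pr (fun=> resample rho c) (fun s =>
    d (along (fun j p => (X (hybrid I j p), X (hybrid (I :|: J) j p))) s)).
  rewrite /sensitivity (eq_Pr _ (E' := fun s =>
    d (along (fun j p => (X p.1, X (hybrid J j p))) s))); last first.
    by move=> s; rewrite /d /voterwise !along_comp.
  apply: eq_Pr_law => j u; rewrite /hybrid inE.
  have := disjointFr hIJ (x := j).
  case: (j \in I) => /= [/(_ isT) ->|_]; last by [].
  by rewrite (resample_fst c hpos (fun t => (X t, X t) == u))
             (resample_snd c hpos (fun t => (X t, X t) == u)).
apply: Pr_leU => // s.
rewrite /d /voterwise !along_comp /=.
by case: (f _) (f _) (f _) => [] [] [].
Qed.

End Sensitivity.

(** * Three functions that are rarely all equal *)

(** Resampling within the classes of c leads from any value of X to any other,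
so that the old and the new value of X cross. *)
Definition rich (T : Type) (D : eqType) (X : T -> bool) (c : T -> D) : Prop :=
  forall x x', exists t t', [/\ X t = x, X t' = x' & c t = c t'].

(** The triples of preferences on (a,b), (b,c), (c,a) that rankings induce are
exactly those that are not all equal. *)
Definition nae_triple (T : Type) (X Y Z : T -> bool) : Prop :=
  (forall t, ~~ ((X t == Y t) && (Y t == Z t))) /\
  (forall x y z, ~~ ((x == y) && (y == z)) ->
     exists t, [/\ X t = x, Y t = y & Z t = z]).

Lemma nae_triple_rot T (X Y Z : T -> bool) :
  nae_triple X Y Z -> nae_triple Y Z X.
Proof.
move=> [h1 h2]; split=> [t|y z x h].
  by have := h1 t; case: (X t) (Y t) (Z t) => [] [] [].
by have [|t []] := h2 x y z; [move: h; case: x y z => [] [] [] | exists t].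
Qed.

(** With y different from z, both values of x complete the triple. *)
Lemma nae_triple_rich (T : Type) (X Y Z : T -> bool) :
  nae_triple X Y Z -> rich X (fun t => (Y t, Z t)).
Proof.
move=> [_ h] x x'.
have [|t [hx hy hz]] := h x false true; first by case: x.
have [|t' [hx' hy' hz']] := h x' false true; first by case: x'.
by exists t, t'; split; rewrite ?hx ?hx' ?hy ?hy' ?hz ?hz'.
Qed.

Definition near_junta (R : realType) (n : nat) (T : finType) (rho : T -> R)
    (tau : R) (X : T -> bool) (f : {ffun 'I_n -> bool} -> bool) : Prop :=
  exists (i : 'I_n) (u : bool -> bool),
    Pr (fun=> rho) (fun s => f (voterwise X s) != u (X (s i))) <= tau.

Definition near_const (R : realType) (n : nat) (T : finType) (rho : T -> R)
    (tau : R) (X : T -> bool) (f : {ffun 'I_n -> bool} -> bool)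
    (v : bool) : Prop :=
  Pr (fun=> rho) (fun s => f (voterwise X s) != v) <= tau.

Definition Pr_all_equal (R : realType) (n : nat) (T : finType) (rho : T -> R)
    (X Y Z : T -> bool) (f g h : {ffun 'I_n -> bool} -> bool) : R :=
  Pr (fun=> rho) (fun s => (f (voterwise X s) == g (voterwise Y s)) &&
                           (g (voterwise Y s) == h (voterwise Z s))).

Lemma Pr_all_equal_rot (R : realType) (n : nat) (T : finType) (rho : T -> R)
    (X Y Z : T -> bool) (f g h : {ffun 'I_n -> bool} -> bool) :
  Pr_all_equal rho Y Z X g h f = Pr_all_equal rho X Y Z f g h.
Proof. by apply: eq_Pr => s; case: (f _) (g _) (h _) => [] [] []. Qed.

Section NearlyTransitiveTriple.
Variables (R : realType) (T : finType) (rho : T -> R) (b : R) (C : nat).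
Hypotheses (hrho : is_distribution rho) (b0 : 0 < b).
Hypothesis hb : forall t, b <= rho t.
Hypothesis hC : cross_exponent (b ^+ 2) C.

Let hpos t : 0 < rho t.
Proof. exact: lt_le_trans b0 (hb t). Qed.

Lemma resample_cross (D : eqType) (c : T -> D) (X : T -> bool) (n : nat)
    (A B : pred {ffun 'I_n -> bool}) : rich X c ->
  (Pr (fun=> rho) (fun s => A (voterwise X s)) *
   Pr (fun=> rho) (fun s => B (voterwise X s))) ^+ C <=
  Pr (fun=> resample rho c) (fun s => A (voterwise (fun p => X p.1) s) &&
                                      B (voterwise (fun p => X p.2) s)).
Proof.
move=> hX; have -> : Pr (fun=> rho) (fun s => A (voterwise X s)) =
    Pr (fun=> resample rho c) (fun s => A (voterwise (fun p => X p.1) s)).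
  apply: eq_Pr_law => j u.
  by rewrite (resample_fst c hpos (fun t => X t == u)).
have -> : Pr (fun=> rho) (fun s => B (voterwise X s)) =
    Pr (fun=> resample rho c) (fun s => B (voterwise (fun p => X p.2) s)).
  apply: eq_Pr_law => j u.
  by rewrite (resample_snd c hpos (fun t => X t == u)).
apply: hC => j; first exact: resample_distribution.
move=> p p' _ _; have [t [t' [h1 h2 h3]]] := hX (X p.1) (X p'.2).
by exists (t, t'); split=> //=; apply: resample_ge.
Qed.

(** The old and the new vector cross, so that f is true on the one and false on
the other with probability bounded below. *)
Lemma sensitivity_setT_ge (D : eqType) (c : T -> D) (X : T -> bool) (n : nat)
    (f : {ffun 'I_n -> bool} -> bool) : rich X c ->
  (Pr (fun=> rho) (fun s => f (voterwise X s)) *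
   Pr (fun=> rho) (fun s => ~~ f (voterwise X s))) ^+ C <=
  sensitivity rho c X f setT.
Proof.
move=> hX; apply: le_trans (resample_cross f (fun u => ~~ f u) hX) _.
apply: Pr_le => [j|s]; first exact: resample_distribution.
have -> : along (fun j p => X (hybrid setT j p)) s =
    voterwise (fun p => X p.2) s.
  by apply/ffunP => j; rewrite !ffunE /hybrid inE.
by case: (f _) (f _) => [] [].
Qed.

(** Voters in I resample with y and z kept, the others with x and z kept. If f
and g both change, choose among the old and new vectors those at which f and g
equal the unchanged value of h. *)
Lemma sensitivity_dichotomy (X Y Z : T -> bool) (n : nat)
    (f g h : {ffun 'I_n -> bool} -> bool) (I : {set 'I_n}) :
  nae_triple X Y Z ->
  (sensitivity rho (fun t => (Y t, Z t)) X f I *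
   sensitivity rho (fun t => (X t, Z t)) Y g (~: I)) ^+ C <=
  4 * Pr (fun=> rho) (fun s => (f (voterwise X s) == g (voterwise Y s)) &&
                               (g (voterwise Y s) == h (voterwise Z s))).
Proof.
move=> [_ hXYZ].
set cX := fun t => (Y t, Z t); set cY := fun t => (X t, Z t).
pose W (j : 'I_n) := if j \in I then resample rho cX else resample rho cY.
have hW j : is_distribution (W j).
  by rewrite /W; case: ifP => _; apply: resample_distribution.
have W1 j P : \sum_(p | P p.1) W j p = \sum_(t | P t) rho t.
  by rewrite /W; case: ifP => _; rewrite resample_fst.
have W2 j P : \sum_(p | P p.2) W j p = \sum_(t | P t) rho t.
  by rewrite /W; case: ifP => _; rewrite resample_snd.
pose phi j (p : T * T) := (X p.1, X (hybrid I j p)).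
pose psi j (p : T * T) := (Y p.1, Y (hybrid (~: I) j p)).
pose d (k : {ffun 'I_n -> bool} -> bool) (u : {ffun 'I_n -> bool * bool}) :=
  k (voterwise fst u) != k (voterwise snd u).
have -> : sensitivity rho cX X f I = Pr W (fun s => d f (along phi s)).
  rewrite /sensitivity (eq_Pr _ (E' := fun s => d f (along phi s))); last first.
    by move=> s; rewrite /d /voterwise !along_comp.
  apply: eq_Pr_law => j u; rewrite /phi /W /hybrid; case: ifP => // _.
  by rewrite !(resample_fst _ hpos (fun t => (X t, X t) == u)).
have -> : sensitivity rho cY Y g (~: I) = Pr W (fun s => d g (along psi s)).
  rewrite /sensitivity (eq_Pr _ (E' := fun s => d g (along psi s))); last first.
    by move=> s; rewrite /d /voterwise !along_comp.
  apply: eq_Pr_law => j u; rewrite /psi /W /hybrid inE; case: (j \in I) => //=.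
  by rewrite !(resample_fst _ hpos (fun t => (Y t, Y t) == u)).
(* A voter in I keeps y, and any pair of old and new values of x is compatible
   with that y when z is its negation; symmetrically for a voter outside I. *)
apply: le_trans (hC hW _ (d f) (d g)) _.
  move=> j p p' _ _; rewrite /phi /psi /W /hybrid inE; case: (j \in I) => /=.
    have [|t [hx hy hz]] := hXYZ (X p.1) (Y p'.1) (~~ Y p'.1).
      by case: (X _) (Y _) => [] [].
    have [|t' [hx' hy' hz']] := hXYZ (X p.2) (Y p'.1) (~~ Y p'.1).
      by case: (X _) (Y _) => [] [].
    exists (t, t'); rewrite /= hx hy hx'; split=> //.
    by apply: resample_ge => //; rewrite /cX hy hy' hz hz'.
  have [|t [hx hy hz]] := hXYZ (X p.1) (Y p'.1) (~~ X p.1).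
    by case: (X _) (Y _) => [] [].
  have [|t' [hx' hy' hz']] := hXYZ (X p.1) (Y p'.2) (~~ X p.1).
    by case: (X _) (Y _) => [] [].
  exists (t, t'); rewrite /= hx hy hy'; split=> //.
  by apply: resample_ge => //; rewrite /cY hx hx' hz hz'.
(* ab tells whether x and y take their new values. Elsewhere a voter may move
   too, but without effect on the preference concerned. *)
pose mix (ab : bool * bool) (j : 'I_n) (p : T * T) :=
  if (if j \in I then ab.1 else ab.2) then p.2 else p.1.
pose bad (s : {ffun 'I_n -> T}) := (f (voterwise X s) == g (voterwise Y s)) &&
                               (g (voterwise Y s) == h (voterwise Z s)).
apply: (@le_trans _ _
  (\sum_(ab : bool * bool) Pr W (fun s => bad (along (mix ab) s)))).
  apply: Pr_le_sum => // s hs; rewrite /d /voterwise !along_comp /phi /psi /=.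
  have hZ ab : along (fun j p => Z (mix ab j p)) s = along (fun j p => Z p.1) s.
    apply/ffunP => j; rewrite !ffunE /mix; have := hs j.
    rewrite /W /resample.
    case: (j \in I); case: ifP => //; case: ifP; rewrite ?ltxx //.
      by move=> _ /eqP [_ ->].
    by move=> _ /eqP [_ ->].
  have hX ab : along (fun j p => X (mix ab j p)) s =
      along (fun j p => if ab.1 then X (hybrid I j p) else X p.1) s.
    apply/ffunP => j; rewrite !ffunE /mix /hybrid; have := hs j.
    rewrite /W /resample; case: (j \in I); first by case: ab.1.
    case: ifP; rewrite ?ltxx // => /eqP [e _] _.
    by case: (ab.1) (ab.2) => [] []; rewrite /= ?e.
  have hY ab : along (fun j p => Y (mix ab j p)) s =
      along (fun j p => if ab.2 then Y (hybrid (~: I) j p) else Y p.1) s.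
    apply/ffunP => j; rewrite !ffunE /mix /hybrid inE; have := hs j.
    rewrite /W /resample; case: (j \in I) => /=; last by case: ab.2.
    case: ifP; rewrite ?ltxx // => /eqP [e _] _.
    by case: (ab.1) (ab.2) => [] []; rewrite /= ?e.
  case/andP => hf hg.
  set v := h (along (fun j p => Z p.1) s).
  have pickE (k : {ffun 'I_n -> bool} -> bool) (q q' : 'I_n -> T * T -> bool) :
      k (along q s) != k (along q' s) ->
      k (along (fun j p => if k (along q s) != v then q' j p else q j p) s) = v.
    case: (eqVneq (k (along q s)) v) => [//|] /=.
    by case: (k (along q s)) (k (along q' s)) v => [] [] [].
  exists (f (along (fun j p => X p.1) s) != v,
          g (along (fun j p => Y p.1) s) != v).
  by rewrite /bad /voterwise !along_comp hX hY hZ -/v !pickE ?eqxx.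
rewrite (eq_bigr (fun=> Pr (fun=> rho) bad)).
  by rewrite big_const card_prod card_bool /= addr0; lra.
move=> ab _; transitivity (Pr (fun=> rho) (fun s => bad (along (fun=> id) s))).
  apply: eq_Pr_law => j u; rewrite /mix.
  case: ifP => _; case: (ab) => [[] []] /=;
  by [apply: (W1 j (fun t => t == u)) | apply: (W2 j (fun t => t == u))].
by apply: eq_Pr => s; congr bad; apply/ffunP => j; rewrite ffunE.
Qed.

Hypothesis C0 : (0 < C)%N.

(** An approximate ultrafilter on a finite set is principal. The voter found is
the last one of the shortest initial segment to which f is sensitive; the other
voters are the union of the previous segment, to which f is insensitive, and of
the complement of this one, to which f is insensitive by the dichotomy. *)
Lemma sensitivity_concentrates (D : eqType) (c : T -> D) (X : T -> bool)
    (n : nat) (f : {ffun 'I_n -> bool} -> bool) (eta : R) :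
  (forall I : {set 'I_n}, sensitivity rho c X f I <= eta \/
                          sensitivity rho c X f (~: I) <= eta) ->
  eta < sensitivity rho c X f setT ->
  exists i, sensitivity rho c X f (~: [set i]) <= 2 * eta.
Proof.
move=> dich hT; pose pre m : {set 'I_n} := [set j : 'I_n | (j < m)%N].
pose heavy m := eta < sensitivity rho c X f (pre m).
have ex : exists m, heavy m.
  exists n; rewrite /heavy (_ : pre n = setT) //.
  by apply/setP => j; rewrite !inE ltn_ord.
case: (ex_minnP ex) => -[|m] hm min.
  have pre0 : pre 0%N = set0 by apply/setP => j; rewrite !inE.
  move: hm; rewrite /heavy pre0 => hm.
  by have [] := dich set0; rewrite ?setC0 leNgt ?hm ?hT.
have hm1 : sensitivity rho c X f (pre m) <= eta.
  by rewrite leNgt; apply/negP => /min; rewrite ltnn.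
have mn : (m < n)%N.
  rewrite ltnNge; apply/negP => nm; move: hm1; rewrite leNgt => /negP; apply.
  rewrite (_ : pre m = setT) //; apply/setP => j; rewrite !inE.
  exact: leq_trans (ltn_ord j) nm.
have hm2 : sensitivity rho c X f (~: pre m.+1) <= eta.
  by have [] := dich (pre m.+1) => //; rewrite leNgt -/(heavy _) hm.
exists (Ordinal mn).
have -> : ~: [set Ordinal mn] = pre m :|: ~: pre m.+1.
  apply/setP => j; rewrite !inE -val_eqE /= -leqNgt.
  by rewrite neq_ltn.
apply: le_trans (sensitivityU c X f hrho hpos _) _; last lra.
rewrite disjoints_subset; apply/subsetP => j; rewrite !inE negbK.
exact: ltnW.
Qed.

Lemma Pr_prod_small (a a' t : R) : 0 < t ->
  (a * a') ^+ C <= (t ^+ 2) ^+ C -> a <= t \/ a' <= t.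
Proof.
move=> t0 h; have [//|ha] := leP a t; first by left.
have [//|ha'] := leP a' t; first by right.
move: h; rewrite leNgt => /negP []; rewrite ltrXn2r ?exprn_ge0 ?ltW //.
  by rewrite -lt0n.
by rewrite expr2 ltr_pM // ltW.
Qed.

(** Given a value v, the events x_i = v, f = true and x_i = v, f = false cannot
both have large probability: they would meet across the resampling, and there
f changes although voter i keeps its value. *)
Lemma insensitive_near_junta (D : eqType) (c : T -> D) (X : T -> bool) (n : nat)
    (f : {ffun 'I_n -> bool} -> bool) (i : 'I_n) (tau : R) :
  rich X c -> 0 < tau ->
  sensitivity rho c X f (~: [set i]) <= ((tau / 2) ^+ 2) ^+ C ->
  near_junta rho tau X f.
Proof.
move=> hX t0 hS.
pose P v w := Pr (fun=> rho)
  (fun s => (voterwise X s i == v) && (f (voterwise X s) == w)).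
have hP v : P v true <= tau / 2 \/ P v false <= tau / 2.
  apply: Pr_prod_small; first by rewrite divr_gt0.
  apply: le_trans (resample_cross (fun u => (u i == v) && (f u == true))
    (fun u => (u i == v) && (f u == false)) hX) _.
  apply: le_trans hS; apply: Pr_le => [j|s]; first exact: resample_distribution.
  case/andP => /andP [/eqP h1 /eqP h2] /andP [/eqP h3 /eqP h4].
  rewrite h2 (_ : along _ s = voterwise (fun p => X p.2) s) ?h4 //.
  apply/ffunP => j; rewrite !ffunE /hybrid !inE; case: eqVneq => //= ->.
  by move: h1 h3; rewrite !ffunE => -> ->.
exists i, (fun v => ~~ (P v true <= tau / 2)).
apply: (@le_trans _ _ (\sum_v P v (P v true <= tau / 2))).
  apply: Pr_le_sum => [//|s _ hs]; exists (X (s i)); rewrite ffunE eqxx /=.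
  by move: hs; case: (f _); case: (_ <= _).
rewrite big_bool /=.
have h v : P v (P v true <= tau / 2) <= tau / 2.
  case: (boolP (P v true <= tau / 2)) => // /negbTE hn.
  by case: (hP v); rewrite ?hn.
by have := h true; have := h false; lra.
Qed.

(** If f were sensitive both to I and to its complement, the dichotomy would
make g insensitive to both, hence to all voters, although g is far from
constant. *)
Lemma nonconst_near_junta (X Y Z : T -> bool) (n : nat)
    (f g h : {ffun 'I_n -> bool} -> bool) (theta tau eta : R) :
  nae_triple X Y Z -> 0 < theta -> 0 < tau -> 0 < eta ->
  2 * eta <= ((tau / 2) ^+ 2) ^+ C -> 2 * eta < (theta ^+ 2) ^+ C ->
  4 * Pr_all_equal rho X Y Z f g h <= (eta ^+ 2) ^+ C ->
  (forall v, ~ near_const rho theta X f v) ->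
  (forall v, ~ near_const rho theta Y g v) ->
  near_junta rho tau X f.
Proof.
move=> hXYZ th0 tau0 eta0 e1 e2 e3 hf hg.
set cX := fun t => (Y t, Z t); set cY := fun t => (X t, Z t).
have richX : rich X cX by apply: nae_triple_rich hXYZ.
have richY : rich Y cY.
  move=> y y'.
  have [t [t' [h1 h2 [h3 h4]]]] := nae_triple_rich (nae_triple_rot hXYZ) y y'.
  by exists t, t'; split=> //; rewrite /cY h3 h4.
have big (D : eqType) (c : T -> D) W (k : {ffun 'I_n -> bool} -> bool) :
    rich W c -> (forall v, ~ near_const rho theta W k v) ->
    2 * eta < sensitivity rho c W k setT.
  move=> hW hk; apply: lt_le_trans e2 (le_trans _ (sensitivity_setT_ge k hW)).
  have hk1 : theta < Pr (fun=> rho) (fun s => k (voterwise W s)).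
    have /negP := hk false; rewrite -ltNge /near_const => h1.
    by apply: lt_le_trans h1 _; apply: Pr_le => // s; case: (k _).
  have hk2 : theta < Pr (fun=> rho) (fun s => ~~ k (voterwise W s)).
    have /negP := hk true; rewrite -ltNge /near_const => h1.
    by apply: lt_le_trans h1 _; apply: Pr_le => // s; case: (k _).
  apply: lerXn2r; rewrite ?nnegrE ?exprn_ge0 ?mulr_ge0 ?Pr_ge0 //.
    exact: ltW.
  by rewrite expr2 ler_pM // ltW.
have fT := big _ _ _ _ richX hf; have gT := big _ _ _ _ richY hg.
have dich I : sensitivity rho cX X f I <= eta \/
              sensitivity rho cY Y g (~: I) <= eta.
  apply: Pr_prod_small => //.
  exact: le_trans (sensitivity_dichotomy f g h I hXYZ) e3.
have dichf I : sensitivity rho cX X f I <= eta \/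
               sensitivity rho cX X f (~: I) <= eta.
  have [|hI] := dich I; first by left.
  have [|hI'] := dich (~: I); first by right.
  have := sensitivityU cY Y g hrho hpos (I := I) (J := ~: I).
  rewrite setUCr -setI_eq0 setICr eqxx => /(_ isT).
  by rewrite setCK in hI'; lra.
have [|i hi] := sensitivity_concentrates dichf; first by lra.
exact: (insensitive_near_junta richX tau0 (le_trans hi e1)).
Qed.

(** Where f = g = v, either h differs from v or all three agree; both are
improbable, whereas the events f = v and g = v cross. *)
Lemma near_const_cascade (X Y Z : T -> bool) (n : nat)
    (f g h : {ffun 'I_n -> bool} -> bool) (tau theta : R) (v : bool) :
  nae_triple X Y Z -> 0 < tau ->
  Pr_all_equal rho X Y Z f g h + theta <= (tau ^+ 2) ^+ C ->
  near_const rho theta Z h v ->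
  near_const rho tau X f (~~ v) \/ near_const rho tau Y g (~~ v).
Proof.
move=> [_ hXYZ] tau0 e hh; rewrite /near_const.
have eqv (W : T -> bool) (k : {ffun 'I_n -> bool} -> bool) :
    Pr (fun=> rho) (fun s => k (voterwise W s) != ~~ v) =
    Pr (fun=> rho) (fun s => k (voterwise W s) == v).
  apply: eq_Pr => s; rewrite -[RHS]negbK; congr (~~ _).
  by case: (k _); case: (v).
rewrite !eqv; apply: Pr_prod_small => //; apply: le_trans e.
apply: le_trans (hC _ _ (fun u => f u == v) (fun u => g u == v)) _ => //.
  move=> _ t t' _ _; have [|t'' [h1 h2 _]] := hXYZ (X t) (Y t') (~~ X t).
    by case: (X t) (Y t') => [] [].
  exists t''; split=> //; apply: le_trans (hb t'').
  rewrite expr2 ler_piMr ?(ltW b0) //.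
  apply: le_trans (hb t'') _; case: hrho => r0 <-.
  by rewrite (bigD1 t'') //= lerDl sumr_ge0.
apply: le_trans (Pr_leU _ _) (lerD (lexx _) hh) => // s.
rewrite -/(voterwise X s) -/(voterwise Y s) => /andP [/eqP -> /eqP ->].
by rewrite eqxx eq_sym; case: eqP.
Qed.

Definition opposite_consts (n : nat) (tau : R) (X Y : T -> bool)
    (f g : {ffun 'I_n -> bool} -> bool) : Prop :=
  exists v, near_const rho tau X f v /\ near_const rho tau Y g (~~ v).

(** The constants are chosen backwards: theta is small enough for
[near_const_cascade] to conclude at level tau, eta is small compared with the
sensitivity of functions that are theta-far from constant and small enough for
[insensitive_near_junta], and delta makes the dichotomy hold at level eta. *)
Lemma near_all_equal_free (X Y Z : T -> bool) (tau : R) :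
  nae_triple X Y Z -> 0 < tau ->
  exists2 delta : R, 0 < delta &
  forall (n : nat) (f g h : {ffun 'I_n -> bool} -> bool),
  Pr_all_equal rho X Y Z f g h <= delta ->
  [/\ near_junta rho tau X f, near_junta rho tau Y g
    & near_junta rho tau Z h] \/
  [\/ opposite_consts tau X Y f g, opposite_consts tau Y Z g h
    | opposite_consts tau Z X h f].
Proof.
move=> hXYZ tau0.
have hYZX := nae_triple_rot hXYZ; have hZXY := nae_triple_rot hYZX.
pose theta := Num.min tau ((tau ^+ 2) ^+ C / 2).
have th0 : 0 < theta by rewrite lt_min tau0 divr_gt0 ?exprn_gt0.
pose eta := Num.min (((tau / 2) ^+ 2) ^+ C / 2) ((theta ^+ 2) ^+ C / 3).
have eta0 : 0 < eta by rewrite lt_min !divr_gt0 ?exprn_gt0 ?divr_gt0.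
have [tht thC] : theta <= tau /\ theta <= (tau ^+ 2) ^+ C / 2.
  by apply/andP; rewrite -le_min.
have [et1 et2] : eta <= ((tau / 2) ^+ 2) ^+ C / 2 /\
                 eta <= (theta ^+ 2) ^+ C / 3.
  by apply/andP; rewrite -le_min.
have thC0 : 0 < (theta ^+ 2) ^+ C by rewrite !exprn_gt0.
have e1 : 2 * eta <= ((tau / 2) ^+ 2) ^+ C by lra.
have e2 : 2 * eta < (theta ^+ 2) ^+ C by lra.
exists (Num.min theta ((eta ^+ 2) ^+ C / 4)).
  by rewrite lt_min th0 divr_gt0 ?exprn_gt0.
move=> n f g h; rewrite le_min => /andP [hd1 hd2].
have e3 : 4 * Pr_all_equal rho X Y Z f g h <= (eta ^+ 2) ^+ C by lra.
have e4 : Pr_all_equal rho X Y Z f g h + theta <= (tau ^+ 2) ^+ C by lra.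
have weak W (k : {ffun 'I_n -> bool} -> bool) v :
    near_const rho theta W k v -> near_const rho tau W k v.
  by move=> hk; apply: le_trans hk tht.
have dec W (k : {ffun 'I_n -> bool} -> bool) :
    (exists v, near_const rho theta W k v) \/
    forall v, ~ near_const rho theta W k v.
  have [h1|h1] := boolP
      (Pr (fun=> rho) (fun s => k (voterwise W s) != true) <= theta).
    by left; exists true.
  have [h2|h2] := boolP
      (Pr (fun=> rho) (fun s => k (voterwise W s) != false) <= theta).
    by left; exists false.
  by right=> -[]; apply/negP.
have r1 := Pr_all_equal_rot rho X Y Z f g h.
have r2 := Pr_all_equal_rot rho Y Z X g h f.
have [[v hv]|nh] := dec Z h.
  right; have [hf|hg] := near_const_cascade hXYZ tau0 e4 hv.
    by apply: Or33; exists v; split; first exact: weak.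
  by apply: Or32; exists (~~ v); rewrite negbK; split; last exact: weak.
have [[v hv]|nf] := dec X f.
  rewrite -r1 in e4; right; have [hg|hh] := near_const_cascade hYZX tau0 e4 hv.
    by apply: Or31; exists v; split; first exact: weak.
  by apply: Or33; exists (~~ v); rewrite negbK; split; last exact: weak.
have [[v hv]|ng] := dec Y g.
  rewrite -r1 -r2 in e4; right.
  have [hh|hf] := near_const_cascade hZXY tau0 e4 hv.
    by apply: Or32; exists v; split; first exact: weak.
  by apply: Or31; exists (~~ v); rewrite negbK; split; last exact: weak.
left; split.
- exact: (nonconst_near_junta hXYZ th0 tau0 eta0 e1 e2 e3).
- rewrite -r1 in e3.
  by apply: (nonconst_near_junta hYZX th0 tau0 eta0 e1 e2 e3).
- rewrite -r1 -r2 in e3.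
  by apply: (nonconst_near_junta hZXY th0 tau0 eta0 e1 e2 e3).
Qed.

End NearlyTransitiveTriple.

(** * Rankings and pairwise preferences *)

Section Rankings.
Variable k : nat.
Implicit Types (a b c : 'I_k) (x : preferences k).

Lemma ranks_aboveN a b (t : 'S_k) :
  a != b -> ranks_above t b a = ~~ ranks_above t a b.
Proof.
move=> ab; rewrite /ranks_above -leqNgt [RHS]leq_eqVlt.
by rewrite (inj_eq val_inj) (inj_eq perm_inj) eq_sym (negbTE ab).
Qed.

(** Two transpositions bring a and b to the first two positions. *)
Lemma exists_ranking a b c : a != b -> b != c -> a != c ->
  exists t : 'S_k, (t a < t b)%N && (t b < t c)%N.
Proof.
move=> ab bc ac.
have k3 : (2 < k)%N.
  rewrite -[k]card_ord; apply: leq_trans (max_card (mem [:: a; b; c])).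
  by rewrite (card_uniqP _) //= !inE negb_or ab ac bc.
pose o0 : 'I_k := Ordinal (ltnW (ltnW k3)); pose o1 : 'I_k := Ordinal (ltnW k3).
pose t1 := tperm a o0; pose t := (t1 * tperm (t1 b) o1)%g.
have ta : t a = o0.
  have t1b : t1 b != o0 by rewrite -(tpermL a o0) (inj_eq perm_inj) eq_sym.
  by rewrite permM /t1 tpermL tpermD.
have tb : t b = o1 by rewrite permM tpermL.
exists t; rewrite ta tb /=.
have : t c != o0 by rewrite -ta (inj_eq perm_inj) eq_sym.
have : t c != o1 by rewrite -tb (inj_eq perm_inj) eq_sym.
by rewrite -!val_eqE /=; case: (nat_of_ord (t c)) => [|[|m]].
Qed.

Lemma nae_triple_ranks_above a b c : a != b -> b != c -> a != c ->
  nae_triple (fun t : 'S_k => ranks_above t a b) (fun t => ranks_above t b c)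
             (fun t => ranks_above t c a).
Proof.
move=> ab bc ac; split=> [t|x y z].
  have ba := ranks_aboveN t ab; have cb := ranks_aboveN t bc.
  have ca := ranks_aboveN t ac.
  move: ba cb ca; rewrite /ranks_above.
  case: ltnP; case: ltnP; case: ltnP; lia.
have [ba [cb ca]] : b != a /\ c != b /\ c != a.
  by rewrite ![_ == a]eq_sym [c == b]eq_sym.
have key p q r : p != q -> q != r -> p != r -> exists t : 'S_k,
    [/\ ranks_above t p q, ranks_above t q r, ranks_above t p r
      & [/\ ranks_above t q p = false, ranks_above t r q = false
        & ranks_above t r p = false]].
  move=> pq qr pr; have [t /andP [h1 h2]] := exists_ranking pq qr pr.
  have h3 := ltn_trans h1 h2.
  exists t; rewrite /ranks_above h1 h2 h3; split=> //.
  by split; apply: negbTE; rewrite -leqNgt ltnW.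
case: x y z => [] [] [] //= _.
- by have [t [? ? ? [? ? ?]]] := key a b c ab bc ac; exists t.
- by have [t [? ? ? [? ? ?]]] := key c a b ca ab cb; exists t.
- by have [t [? ? ? [? ? ?]]] := key a c b ac cb ab; exists t.
- by have [t [? ? ? [? ? ?]]] := key b c a bc ca ba; exists t.
- by have [t [? ? ? [? ? ?]]] := key b a c ba ac bc; exists t.
- by have [t [? ? ? [? ? ?]]] := key c b a cb ba ca; exists t.
Qed.

Lemma prefers_lt x a b (ab : (a < b)%N) :
  prefers x a b = x (Sub (a, b) ab : altpair k).
Proof. by rewrite /prefers insubT. Qed.

Lemma prefers_val x (p : altpair k) : prefers x (val p).1 (val p).2 = x p.
Proof. by rewrite /prefers -surjective_pairing valK. Qed.

Lemma altpair_neq (p : altpair k) : (val p).1 != (val p).2.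
Proof. by have lt_p := valP p; rewrite neq_ltn lt_p. Qed.

Lemma prefersxx x a : prefers x a a = false.
Proof. by rewrite /prefers !insubN //= ltnn. Qed.

Lemma prefersN x a b : a != b -> prefers x b a = ~~ prefers x a b.
Proof.
rewrite -val_eqE neq_ltn => /orP [] lt_ab; rewrite /prefers.
  by rewrite insubN ?insubT //= -leqNgt ltnW.
by rewrite insubT [in RHS]insubN ?negbK //= -leqNgt ltnW.
Qed.

Lemma transitive_prefP x :
  reflect (forall a b c, a != b -> b != c -> a != c ->
             ~~ ((prefers x a b == prefers x b c) &&
                 (prefers x b c == prefers x c a)))
          (transitive_pref x).
Proof.
apply: (iffP idP) => [/forallP tr a b c ab bc ac|h].
  have trans p q r : prefers x p q -> prefers x q r -> prefers x p r.
    move=> h1 h2; have /forallP /(_ q) /forallP /(_ r) := tr p.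
    by rewrite h1 h2.
  have := trans a b c; have := trans c b a.
  rewrite (prefersN x ab) (prefersN x bc) (prefersN x ac).
  case: (prefers x a b) (prefers x b c) (prefers x a c) => [] [] [] //= h1 h2.
    exact: h2.
  exact: h1.
apply/forallP => a; apply/forallP => b; apply/forallP => c.
apply/implyP => /andP [].
case: (eqVneq a b) => [->|ab]; first by rewrite prefersxx.
case: (eqVneq b c) => [->|bc]; first by rewrite prefersxx.
case: (eqVneq a c) => [->|ac].
  by rewrite (prefersN x bc) => /negP.
have := h a b c ab bc ac; rewrite (prefersN x ac).
by case: (prefers x a b) (prefers x b c) (prefers x a c) => [] [] [].
Qed.

Section Pairwise.
Variables (n : nat) (F : profile n k -> preferences k).
Hypothesis iiaF : IIA F.

(** The comparison of a and b by F as a function of the preference vector: under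
IIA any profile with these preferences will do, and each voter uses the identity
ranking or its composition with the exchange of a and b. *)
Definition pairwise a b (u : {ffun 'I_n -> bool}) : bool :=
  prefers (F [ffun j => if u j == (a < b)%N then 1%g else tperm a b]) a b.

Lemma pairwiseE a b s : a != b ->
  pairwise a b (voterwise (fun t => ranks_above t a b) s) = prefers (F s) a b.
Proof.
move=> ab; apply: iiaF => j; rewrite !ffunE /ranks_above.
case: eqP => [->|]; first by rewrite !perm1.
rewrite tpermL tpermR; have : (val a != val b) by rewrite val_eqE.
by case: (ltnP (s j a) (s j b)); case: (ltngtP a b).
Qed.

Lemma near_junta_swap (R : realType) (rho : 'S_k -> R) tau a b : a != b ->
  near_junta rho tau (fun t => ranks_above t b a) (pairwise b a) ->
  near_junta rho tau (fun t => ranks_above t a b) (pairwise a b).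
Proof.
move=> ab [i [u hu]]; exists i, (fun v => ~~ u (~~ v)).
apply: le_trans hu; apply: Pr_le_eq => s.
rewrite pairwiseE // pairwiseE 1?eq_sym // (prefersN _ ab) (ranks_aboveN _ ab).
by case: (prefers _ _ _) (u _) => [] [].
Qed.

End Pairwise.
End Rankings.

(** * Rounding to a transitive function *)

Lemma pos_lower_bound (R : realType) (I : finType) (g : I -> R) :
  (forall i, 0 < g i) -> exists2 b, 0 < b & forall i, b <= g i.
Proof.
move=> g0; exists (\prod_i Num.min 1 (g i)).
  by apply: prodr_gt0 => i _; rewrite lt_min ltr01 g0.
move=> i; rewrite (bigD1 i) //=; apply: (@le_trans _ _ (Num.min 1 (g i))).
  have m0 j : 0 <= Num.min 1 (g j) by rewrite le_min ler01 ltW.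
  rewrite ler_piMr //; apply: prodr_ile1 => j _.
  by rewrite m0 ge_min lexx.
by rewrite ge_min lexx orbT.
Qed.

Lemma Pr_cylinder_ge (R : realType) (n : nat) (T : finType) (rho : T -> R)
    (b : R) (E : pred {ffun 'I_n -> T}) (S : seq 'I_n) (s0 : {ffun 'I_n -> T}) :
  is_distribution rho -> 0 < b -> (forall t, b <= rho t) ->
  (forall s : {ffun 'I_n -> T}, {in S, forall j, s j = s0 j} -> E s) ->
  b ^+ size S <= Pr (fun=> rho) E.
Proof.
move=> hrho b0 hb hE; case: (hrho) => r0 r1.
pose Q j : pred T := fun t => (j \in S) ==> (t == s0 j).
have hQ : Pr (fun=> rho) (fun s => s \in family Q) <= Pr (fun=> rho) E.
  apply: Pr_le => // s /familyP hs; apply: hE => j jS.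
  by have := hs j; rewrite unfold_in /Q jS => /eqP.
apply: le_trans hQ; rewrite /Pr -(bigA_distr_big_dep Q (fun _ t => rho t)).
have b1 : b <= 1.
  case: (pickP (fun _ : T => true)) => [t _|no].
    by apply: le_trans (hb t) _; rewrite -r1 (bigD1 t) //= lerDl sumr_ge0.
  by move: r1; rewrite big_pred0 // => /eqP; rewrite eq_sym oner_eq0.
apply: (@le_trans _ _ (\prod_(j in S) b)).
  rewrite prodr_const; apply: ler_wiXn2l => //; [exact: ltW | exact: card_size].
rewrite big_mkcond /=; apply: ler_prod => j _; apply/andP; split.
  by case: ifP; rewrite ?ler01 // ltW.
rewrite /Q; case: (j \in S) => /=; last by rewrite r1.
by rewrite big_pred1_eq.
Qed.

Lemma junta_rounding (R : realType) (n : nat) (T : finType) (rho : T -> R)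
    (X : T -> bool) (tau : R) (f : {ffun 'I_n -> bool} -> bool) : 0 <= tau ->
  exists2 g : {ffun 'I_n -> bool} -> bool,
    Pr (fun=> rho) (fun s => f (voterwise X s) != g (voterwise X s)) <= tau &
    near_junta rho tau X f ->
    exists (i : 'I_n) (u : bool -> bool), forall y, g y = u (y i).
Proof.
move=> tau0; have [/existsP [i /existsP [u hu]]|hn] := boolP
  [exists i : 'I_n, [exists u : {ffun bool -> bool},
     Pr (fun=> rho) (fun s => f (voterwise X s) != u (X (s i))) <= tau]].
  exists (fun y => u (y i)); last by move=> _; exists i, u.
  by apply: le_trans hu; apply: Pr_le_eq => s; rewrite ffunE.
exists f; first by rewrite /Pr big_pred0 // => s; rewrite eqxx.
case=> i [u hu]; case/negP: hn; apply/existsP; exists i; apply/existsP.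
exists (finfun u); apply: le_trans hu; by apply: Pr_le_eq => s; rewrite ffunE.
Qed.

Theorem theorem1p15 (R : realType) (k : nat) (hk : (3 <= k)%N)
    (rho : 'S_k -> R) (hrho : is_distribution rho)
    (hpos : forall s : 'S_k, 0 < rho s) (epsilon : R) (heps : 0 < epsilon) :
  exists2 delta : R, 0 < delta &
    forall (n : nat) (F : profile n k -> preferences k),
      (1 <= n)%N ->
      IIA F ->
      product_prob rho (fun s => transitive_pref (F s)) >= 1 - delta ->
      exists G : profile n k -> preferences k,
        [/\ forall s, transitive_pref (G s),
            IIA G &
            product_prob rho (fun s => F s != G s) <= epsilon].
Proof.
have [b b0 hb] := pos_lower_bound hpos.
have b1 : b <= 1.
  case: hrho => r0 r1; apply: le_trans (hb 1%g) _.
  by rewrite -r1 (bigD1 1%g) //= lerDl sumr_ge0.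
have [||C C0 hC] := @cross_exponent_exists R (b ^+ 2).
- by rewrite exprn_gt0.
- by rewrite expr_le1 // ltW.
(* With tau and delta at most b ^+ 3 / 8, an error delta + 3 * tau stays below
   the mass b ^+ 3 of a cylinder over three voters. *)
pose tau := Num.min (b ^+ 3 / 8) (epsilon / #|{: altpair k}|.+1%:R).
have tau0 : 0 < tau by rewrite lt_min !divr_gt0 ?exprn_gt0.
have [tau1 tau2] : tau <= b ^+ 3 / 8 /\ tau <= epsilon / #|{: altpair k}|.+1%:R.
  by apply/andP; rewrite -le_min.
have b30 : 0 < b ^+ 3 by rewrite exprn_gt0.
pose good (q : 'I_k * 'I_k * 'I_k) (d : R) := let: (x, y, z) := q in
  x != y -> y != z -> x != z ->
  let X t := ranks_above t x y in let Y t := ranks_above t y z in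
  let Z t := ranks_above t z x in
  forall (n : nat) (f g h : {ffun 'I_n -> bool} -> bool),
  Pr_all_equal rho X Y Z f g h <= d ->
  [/\ near_junta rho tau X f, near_junta rho tau Y g
    & near_junta rho tau Z h] \/
  [\/ opposite_consts rho tau X Y f g, opposite_consts rho tau Y Z g h
    | opposite_consts rho tau Z X h f].
have [dl dl0 hdl] : exists2 d : 'I_k * 'I_k * 'I_k -> R,
    forall q, 0 < d q & forall q, good q (d q).
  apply: (@fin_all_exists2 _ (fun _ => R) (fun _ d => 0 < d) good).
  move=> [[x y] z].
  have [/and3P [xy yz xz]|hn] := boolP [&& x != y, y != z & x != z].
    have [d d0 hd] := near_all_equal_free hrho b0 hb hC C0
      (nae_triple_ranks_above xy yz xz) tau0.
    by exists d => // xy' yz' xz'; exact: hd.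
  by exists 1 => // xy yz xz; rewrite xy yz xz in hn.
have [d d0 hd] := pos_lower_bound dl0.
exists (Num.min d (b ^+ 3 / 8)); first by rewrite lt_min d0 divr_gt0.
move=> n F n0 iiaF hF.
have hbad x y z : x != y -> y != z -> x != z ->
    Pr (fun=> rho) (fun s => (prefers (F s) x y == prefers (F s) y z) &&
       (prefers (F s) y z == prefers (F s) z x)) <= Num.min d (b ^+ 3 / 8).
  move=> xy yz xz.
  apply: (@le_trans _ _ (Pr (fun=> rho) (fun s => ~~ transitive_pref (F s)))).
    apply: Pr_le => // s; apply: contraL => /transitive_prefP tr; exact: tr.
  by rewrite Pr_compl //; move: hF; rewrite /product_prob /Pr; lra.
(* Rounding uses F only through the preference vectors, so G inherits IIA. *)
have [U hU1 hU2] := fin_all_exists2 (fun p : altpair k =>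
  junta_rounding rho (fun t => ranks_above t (val p).1 (val p).2)
    (pairwise F (val p).1 (val p).2) (ltW tau0)).
pose G (s : profile n k) : preferences k :=
  [ffun p => U p (voterwise (fun t => ranks_above t (val p).1 (val p).2) s)].
have iiaG : IIA G.
  have lt_iia (x y : 'I_k) (s t : profile n k) : (x < y)%N ->
      (forall j, ranks_above (s j) x y = ranks_above (t j) x y) ->
      prefers (G s) x y = prefers (G t) x y.
    move=> xy e; rewrite !prefers_lt !ffunE; congr (U _).
    by apply/ffunP => j; rewrite !ffunE.
  move=> x y s t e.
  case: (ltngtP x y) => [xy|yx|/val_inj ->]; last by rewrite !prefersxx.
    exact: lt_iia.
  have yx' : y != x by rewrite -val_eqE ltn_eqF.
  rewrite !(prefersN _ yx') (lt_iia y x s t) // => j.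
  by apply: negb_inj; rewrite -!ranks_aboveN.
pose diff x y (s : profile n k) := prefers (F s) x y != prefers (G s) x y.
pose rounded x y := Pr (fun=> rho) (diff x y) <= tau /\
  (near_junta rho tau (fun t => ranks_above t x y) (pairwise F x y) ->
   exists (i : 'I_n) (u : 'S_k -> bool), forall s, prefers (G s) x y = u (s i)).
have closeG x y : x != y -> rounded x y.
  have lt_close (x' y' : 'I_k) : (x' < y')%N -> rounded x' y'.
    move=> xy; pose p : altpair k := Sub (x', y') xy; split.
      have := hU1 p; rewrite (_ : val p = (x', y')) //=.
      apply: le_trans; apply: Pr_le_eq => s.
      rewrite /diff pairwiseE -?val_eqE ?ltn_eqF //.
      by rewrite (prefers_lt (G s) xy) ffunE.
    move=> /(hU2 p) [i [u hu]].
    exists i, (fun t => u (ranks_above t x' y')) => s.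
    by rewrite prefers_lt ffunE hu !ffunE.
  move=> xy; move: (xy); rewrite -val_eqE neq_ltn.
  move=> /orP [/lt_close //|/lt_close [h1 h2]].
  split.
    apply: le_trans h1; apply: Pr_le_eq => s.
    rewrite /diff ![prefers _ y x]prefersN //.
    by case: (prefers _ _ _) (prefers _ _ _) => [] [].
  move=> hj; have [|i [u hu]] := h2 _.
    by apply: near_junta_swap => //; rewrite eq_sym.
  exists i, (fun t => ~~ u t) => s.
  by rewrite -hu [prefers _ y x]prefersN // negbK.
(* A constant is a function of one voter, so G is rounded on this pair, and a
   value other than v would be taken on a whole cylinder. *)
have constG x y v : x != y ->
    near_const rho tau (fun t => ranks_above t x y) (pairwise F x y) v ->
    forall s, prefers (G s) x y = v.
  move=> xy hv s; have [h1 h2] := closeG x y xy.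
  have [|i [u hu]] := h2 _; first by exists (Ordinal n0), (fun=> v).
  apply/eqP; apply: contraT => hne.
  have : b ^+ 3 <= Pr (fun=> rho) (fun s => prefers (G s) x y != v).
    apply: (@Pr_cylinder_ge _ _ _ _ _ _ [:: i; i; i] s) => // t ht.
    by rewrite hu ht ?inE ?eqxx // -hu.
  have : Pr (fun=> rho) (fun s => prefers (G s) x y != v) <=
    Pr (fun=> rho) (diff x y) + Pr (fun=> rho) (fun s =>
      pairwise F x y (voterwise (fun t => ranks_above t x y) s) != v).
    apply: Pr_leU => // t; rewrite pairwiseE // /diff.
    by case: (eqVneq (prefers (F t) x y) (prefers (G t) x y)) => [->|].
  by rewrite /near_const in hv; lra.
exists G; split=> //.
  move=> s; apply/transitive_prefP => x y z xy yz xz.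
  have zx : z != x by rewrite eq_sym.
  apply/negP => hs; have hd' := hbad x y z xy yz xz.
  have [hd1 hd2] : Num.min d (b ^+ 3 / 8) <= dl (x, y, z) /\
                   Num.min d (b ^+ 3 / 8) <= b ^+ 3 / 8.
    by split; rewrite ge_min ?lexx ?orbT // hd.
  have := @hdl (x, y, z) xy yz xz n (pairwise F x y) (pairwise F y z)
    (pairwise F z x).
  case.
  - apply: le_trans hd1; apply: le_trans hd'.
    by apply: Pr_le_eq => t; rewrite !pairwiseE.
  - case=> /(proj2 (closeG _ _ xy)) [i1 [w1 e1]]
           /(proj2 (closeG _ _ yz)) [i2 [w2 e2]]
           /(proj2 (closeG _ _ zx)) [i3 [w3 e3]].
    pose bad (H : profile n k -> preferences k) s :=
      (prefers (H s) x y == prefers (H s) y z) &&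
      (prefers (H s) y z == prefers (H s) z x).
    have : b ^+ 3 <= Pr (fun=> rho) (bad G).
      apply: (@Pr_cylinder_ge _ _ _ _ _ _ [:: i1; i2; i3] s) => // t ht.
      by rewrite /bad e1 e2 e3 !ht ?inE ?eqxx ?orbT // -e1 -e2 -e3.
    have h1 := proj1 (closeG _ _ xy); have h2 := proj1 (closeG _ _ yz).
    have h3 := proj1 (closeG _ _ zx).
    have u1 : Pr (fun=> rho) (bad G) <= Pr (fun=> rho) (bad F) +
        Pr (fun=> rho) (fun t => diff x y t || (diff y z t || diff z x t)).
      apply: Pr_leU => // t; rewrite /bad /diff.
      case: (prefers (F t) x y) (prefers (F t) y z) (prefers (F t) z x)
        => [] [] [];
      by case: (prefers (G t) x y) (prefers (G t) y z) (prefers (G t) z x)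
        => [] [] [].
    have u2 : Pr (fun=> rho)
          (fun t => diff x y t || (diff y z t || diff z x t)) <=
        Pr (fun=> rho) (diff x y) +
        Pr (fun=> rho) (fun t => diff y z t || diff z x t).
      exact: Pr_leU.
    have u3 : Pr (fun=> rho) (fun t => diff y z t || diff z x t) <=
        Pr (fun=> rho) (diff y z) + Pr (fun=> rho) (diff z x).
      exact: Pr_leU.
    rewrite /bad /diff in hd' *; lra.
  - have opp p q p' q' v : p != q -> p' != q' ->
        near_const rho tau (fun t => ranks_above t p q) (pairwise F p q) v ->
        near_const rho tau (fun t => ranks_above t p' q') (pairwise F p' q')
          (~~ v) ->
        prefers (G s) p q != prefers (G s) p' q'.
      move=> pq pq' hp hp'; rewrite (constG _ _ _ pq hp) (constG _ _ _ pq' hp').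
      by case: (v).
    case/andP: hs => /eqP e1 /eqP e2.
    case=> -[v [hv hv']].
    + by have := opp _ _ _ _ _ xy yz hv hv'; rewrite e1 eqxx.
    + by have := opp _ _ _ _ _ yz zx hv hv'; rewrite e2 eqxx.
    + by have := opp _ _ _ _ _ zx xy hv hv'; rewrite e1 e2 eqxx.
apply: (@le_trans _ _ (\sum_(p : altpair k) tau)).
  apply: le_trans (ler_sum _ (fun p _ => hU1 p)).
  apply: Pr_le_sum => // s _ hne.
  have [p hp] : exists p, F s p != G s p.
    apply/existsP; apply: contraNT hne => /existsPn h; apply/eqP/ffunP => p.
    by apply/eqP; have := h p; rewrite negbK.
  exists p; rewrite pairwiseE ?altpair_neq // prefers_val.
  by move: hp; rewrite ffunE.
rewrite sumr_const -[_ *+ _]mulr_natr; move: tau2; rewrite ler_pdivlMr // => h.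
by apply: le_trans h; rewrite ler_wpM2l ?ltW // ltr_nat.
Qed.
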